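(* Let $X$ be a finite quandle, $S\subset \mathrm{End}(X)$ a set of quandle endomorphisms of $X$, $R$ a commutative ring with identity, and $(t,s)$ a quandle module over $X$ with coefficients in $R$. Then the weighted quiver $\mathcal{Q}_{X,S}^{t,s}(L)$ is an invariant of oriented links: if $D$ and $D'$ are two diagrams of the same oriented link $L$ (equivalently, if $D$ and $D'$ are related by a finite sequence of oriented Reidemeister moves and planar isotopies), then the vertex-weighted directed multigraphs $\mathcal{Q}_{X,S}^{t,s}(D)$ and $\mathcal{Q}_{X,S}^{t,s}(D')$ are isomorphic, that is, there are a bijection of vertices and a compatible bijection of directed edges that preserve the vertex weights.
   Context: A quandle is a set $X$ with a binary operation $\triangleright$ such that (i) $x\triangleright x=x$ for all $x\in X$; (ii) for every $y\in X$ the map $f_y:X\to X$, $f_y(x)=x\triangleright y$, is invertible; (iii) $(x\triangleright y)\triangleright z=(x\triangleright z)\triangleright(y\triangleright z)$ for all $x,y,z\in X$. A quandle endomorphism is a map $f:X\to X$ with $f(x\triangleright y)=f(x)\triangleright f(y)$ for all $x,y\in X$; $\mathrm{End}(X)$ is the set of these. Colorings. Let $D$ be a diagram of an oriented (tame) link. Its arcs are the maximal pieces of the diagram running from undercrossing to undercrossing (a component that never passes under is a single closed arc). An $X$-coloring of $D$ is an assignment of elements of $X$ to the arcs such that at every crossing, if $y$ is the color of the overcrossing arc, $x$ the color of the undercrossing arc lying on the right of the oriented overcrossing strand, and $z$ the color of the undercrossing arc lying on its left, then $z=x\triangleright y$ (regardless of the orientation of the understrand). The set of $X$-colorings is denoted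 $\mathcal{C}(D,X)$. Quandle modules. Maps $t,s:X\times X\to R$, written $t_{x,y}$ and $s_{x,y}$, define a quandle module over $X$ with coefficients in $R$ if for all $x,y,z\in X$ the element $t_{x,y}$ is a unit of $R$ and $$t_{x,x}+s_{x,x}=1,$$ $$t_{x\triangleright y,z}\,t_{x,y}=t_{x\triangleright z,\,y\triangleright z}\,t_{x,z},$$ $$t_{x\triangleright y,z}\,s_{x,y}=s_{x\triangleright z,\,y\triangleright z}\,t_{y,z},$$ $$s_{x\triangleright y,z}=t_{x\triangleright z,\,y\triangleright z}\,s_{x,z}+s_{x\triangleright z,\,y\triangleright z}\,s_{y,z}.$$ Module matrix. Given an $X$-coloring $C$ of $D$, write $D_C$ for the colored diagram. Attach to each arc a variable (a ''bead'') with values in $R$. At each crossing, with arcs colored $x$ (right under-arc), $y$ (over-arc), $x\triangleright y$ (left under-arc) and carrying beads $a,b,c$ respectively, impose the linear equation $c=t_{x,y}a+s_{x,y}b$. The matrix $M_{t,s}(D_C)$ over $R$ is the coefficient matrix of this homogeneous linear system (one row per crossing, one column per arc), and $\mathrm{Ker}\,M_{t,s}(D_C)$ is its solution set, a submodule of $R^{\{\text{arcs of }D\}}$. Quiver. $\mathcal{Q}_{X,S}^{t,s}(D)$ is the directed multigraph having one vertex for each $C\in\mathcal{C}(D,X)$ and, for each vertex $C$ and each $f\in S$, one directed edge from $C$ to the coloring $f(C)$ obtained by applying $f$ to every color. The vertex $C$ is given the weight $|\mathrm{Ker}\,M_{t,s}(D_C)|$ if $R$ is finite, and $\mathrm{Rank}(\mathrm{Ker}\,M_{t,s}(D_C))$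 if $R$ is infinite, where for an $R$-module $N$, $\mathrm{Rank}(N)$ is the number of generators of the free part of $N$, i.e. the largest $r$ such that $N\cong R^r\oplus T$ for some $R$-module $T$. *)

(* Defs.v *)
From HB Require Import structures.
From Stdlib Require Import Relations.
From mathcomp Require Import all_boot all_algebra.
From mathcomp Require Import finmap boolp classical_sets cardinality.

Set Implicit Arguments.
Unset Strict Implicit.
Unset Printing Implicit Defensive.

Import GRing.Theory.

(** * Finite quandles *)

HB.mixin Record isQuandle X := {
  qop : X -> X -> X;
  qop_idem : forall x, qop x x = x;
  qop_bij : forall y, bijective (fun x => qop x y);
  qop_dist : forall x y z, qop (qop x y) z = qop (qop x z) (qop y z)
}.

#[short(type="finQuandleType")]
HB.structure Definition FinQuandle := {X of isQuandle X & Finite X}.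

Notation "x ▷ y" := (qop x y) (at level 40, left associativity).

Section Endomorphisms.
Variable X : finQuandleType.

Record quandle_end := QuandleEnd {
  end_fun :> {ffun X -> X};
  _ : [forall x, forall y, end_fun (x ▷ y) == end_fun x ▷ end_fun y]
}.
HB.instance Definition _ := [isSub for end_fun].
HB.instance Definition _ := [Finite of quandle_end by <:].

Lemma end_funM (f : quandle_end) x y : f (x ▷ y) = f x ▷ f y.
Proof. by case: f => f /= /forallP/(_ x)/forallP/(_ y)/eqP. Qed.

End Endomorphisms.

(** * Diagrams of oriented links

  An oriented link diagram in the plane is the image of a collection of closed
  curves, cut into oriented edges by finitely many vertices: the crossings, and
  2-valent "bends" (marked points, like the corners of a polygonal curve), which
  are there so that crossingless components and the local pieces of strand that
  appear in the Reidemeister moves need no special treatment.  It is recorded by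
  the incidence of edges and vertices, including the cyclic order of the edges
  around each crossing, i.e. as a combinatorial map on the sphere. *)

(** Seen along the oriented over-strand, which goes from [over_in] to
  [over_out], the other two edges are [under_right] and [under_left]; hence
  [over_in], [under_right], [over_out], [under_left] is their counterclockwise
  order.  [positive] tells that the under-strand goes from [under_right] to
  [under_left]; otherwise it goes from [under_left] to [under_right]. *)
Record crossing (L : Type) := Crossing {
  positive : bool;
  over_in : L;
  under_right : L;
  over_out : L;
  under_left : L
}.

(** A bend [(a, b)] joins the end of the edge [a] to the start of [b]. *)
Record code (L : Type) := Code {
  crossings : seq (crossing L);
  bends : seq (L * L)
}.

Section CrossingEq.
Variable L : eqType.
Let enc (c : crossing L) :=
  (positive c, over_in c, under_right c, over_out c, under_left c).
Let dec (u : bool * L * L * L * L) : crossing L :=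
  let: (p, i, r, o, l) := u in Crossing p i r o l.
Let encK : cancel enc dec. Proof. by case. Qed.
HB.instance Definition _ := Equality.copy (crossing L) (can_type encK).
End CrossingEq.

Definition map_crossing (L L' : Type) (f : L -> L') (c : crossing L) :=
  Crossing (positive c) (f (over_in c)) (f (under_right c))
           (f (over_out c)) (f (under_left c)).

Definition map_code (L L' : Type) (f : L -> L') (K : code L) : code L' :=
  Code (map (map_crossing f) (crossings K))
       (map (fun ab => (f ab.1, f ab.2)) (bends K)).

(** The order in which the vertices are listed is immaterial. *)
Definition code_eq (L : eqType) (K K' : code L) :=
  perm_eq (crossings K) (crossings K') && perm_eq (bends K) (bends K').

Section Planarity.
Variables (E : finType) (K : code E).

(** [(e, true)] is the terminal and [(e, false)] the initial half of the edge
  [e]; [stars] lists, vertex by vertex, the half-edges in counterclockwise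
  order. *)
Definition stars : seq (seq (E * bool)) :=
  [seq [:: (over_in c, true); (under_right c, positive c);
           (over_out c, false); (under_left c, ~~ positive c)]
     | c <- crossings K]
  ++ [seq [:: (ab.1, true); (ab.2, false)] | ab <- bends K].

(** Every edge has exactly one start and exactly one end. *)
Definition well_formed := perm_eq (flatten stars) (enum {: E * bool}).

Definition other_half (h : E * bool) : E * bool := (h.1, ~~ h.2).

(** The product of the cycles in [stars], which are disjoint when [K] is
  well-formed. *)
Definition next_at_vertex (h : E * bool) : E * bool :=
  foldr (fun star => next star) h stars.

Definition next_on_face (h : E * bool) : E * bool :=
  next_at_vertex (other_half h).

Definition touching : rel (E * bool) :=
  [rel h k | (k == other_half h) || (k == next_at_vertex h)].

(** Euler's formula V + F = E + 2C: as every connected component satisfies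
  V - E + F <= 2, this says that they all have genus 0. *)
Definition planar :=
  size stars + fcard next_on_face predT == #|E| + (n_comp touching predT).*2.

End Planarity.

Record diagram := Diagram {
  edge : finType;
  diagram_code :> code edge;
  _ : well_formed diagram_code;
  _ : planar diagram_code
}.

(** * Reidemeister moves and planar isotopies *)

(** The crossing obtained from [Crossing p i r o l] by reversing its
  over-strand, unless [d]. *)
Definition orient_over (d : bool) (L : Type) (p : bool) (i r o l : L) :=
  if d then Crossing p i r o l else Crossing (~~ p) o l i r.

(** The bend that goes from [a] to [b] if [d], and from [b] to [a] otherwise. *)
Definition orient_bend (d : bool) (L : Type) (a b : L) :=
  if d then (a, b) else (b, a).

(** Local moves, to be read in both directions.  When the codes are those of
  diagrams, well-formedness makes [g], [h] in R1, R2 and [t1], [m], [b] in R3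
  distinct from the other edges and absent from [cs] and [bs].

  [R1_over_right], ..., [R1_left_over] are the four oriented kinks, named after
  the two consecutive (counterclockwise) edge positions that the loop [g]
  connects.

  In R2 the over-strand runs through [a], [g], [a'], and the edge [h] of the
  under-strand lies on its left, resp. right; [p] gives the direction of the
  under-strand.

  In R3 the top strand [t0], [t1], [t2] is drawn from west to east.  The middle
  strand [mS], [m], [mN] and the bottom strand [bS], [b], [bN] cross it
  and each other, going from the south to the north side if [pm], resp. [pb],
  and from north to south otherwise.  The crossing between them is pushed from
  the north of the top strand to its south.  South of the triangle, the middle
  strand lies west of the bottom strand in [R3_west], and east of it in
  [R3_east]. *)
Inductive move (L : eqType) : code L -> code L -> Prop :=
| Subdivision a b cs bs of a != b :
    move (map_code (fun e => if e == b then a else e) (Code cs bs))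
         (Code cs ((a, b) :: bs))
| R1_over_right a b g cs bs :
    move (Code cs ((a, b) :: bs)) (Code (Crossing true a g g b :: cs) bs)
| R1_left_over a b g cs bs :
    move (Code cs ((a, b) :: bs)) (Code (Crossing true g a b g :: cs) bs)
| R1_over_left a b g cs bs :
    move (Code cs ((a, b) :: bs)) (Code (Crossing false a b g g :: cs) bs)
| R1_right_over a b g cs bs :
    move (Code cs ((a, b) :: bs)) (Code (Crossing false g g b a :: cs) bs)
| R2_left p a a' g b b' h cs bs :
    move (Code cs [:: (a, a'), orient_bend p b b' & bs])
         (Code [:: Crossing p a b g h, Crossing (~~ p) g b' a' h & cs] bs)
| R2_right p a a' g b b' h cs bs :
    move (Code cs [:: (a, a'), orient_bend p b' b & bs])
         (Code [:: Crossing p a h g b, Crossing (~~ p) g h a' b' & cs] bs)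
| R3_west pm pb t0 t1 t2 mS m mN bS b bN cs bs :
    move (Code [:: Crossing pm t0 mS t1 m, Crossing pb t1 bS t2 b,
                   orient_over pm pb m b mN bN & cs] bs)
         (Code [:: Crossing pb t0 b t1 bN, Crossing pm t1 m t2 mN,
                   orient_over pm pb mS bS m b & cs] bs)
| R3_east pm pb t0 t1 t2 mS m mN bS b bN cs bs :
    move (Code [:: Crossing pb t0 bS t1 b, Crossing pm t1 mS t2 m,
                   orient_over pm (~~ pb) m bN mN b & cs] bs)
         (Code [:: Crossing pm t0 m t1 mN, Crossing pb t1 b t2 bN,
                   orient_over pm (~~ pb) mS b m bS & cs] bs).

Definition encodes (K : code nat) (D : diagram) :=
  exists2 f : edge D -> nat, injective f & code_eq (map_code f D) K.

(** Two diagrams with a common code are planar isotopic. *)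
Definition diagram_step (D D' : diagram) :=
  exists K K' : code nat,
    [/\ encodes K D, encodes K' D' & K = K' \/ move K K'].

(** All the diagrams of the connecting sequence are planar, so that an R2 move
  only occurs between edges on the boundary of a common region.  The relative
  position of the connected components of a diagram is not recorded: moving one
  of them into another region of the complement of the others does not change
  the link. *)
Definition same_link : diagram -> diagram -> Prop :=
  clos_refl_sym_trans diagram diagram_step.

(** * Arcs *)

Section Arcs.
Variable D : diagram.

(** Edges that are consecutive along a strand and not separated by an
  undercrossing. *)
Definition joined (e f : edge D) : bool :=
  ((e, f) \in bends D)
  || has (fun c => (over_in c == e) && (over_out c == f)) (crossings D).

Definition arc_class (e : edge D) : {set edge D} :=
  [set f | connect (relU joined (fun x y => joined y x)) e f].

Record arc := Arc {
  arc_set :> {set edge D};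
  _ : [exists e, arc_set == arc_class e]
}.
HB.instance Definition _ := [isSub for arc_set].
HB.instance Definition _ := [Finite of arc by <:].

Lemma arc_of_proof (e : edge D) : [exists e', arc_class e == arc_class e'].
Proof. by apply/existsP; exists e. Qed.

Definition arc_of (e : edge D) : arc := Arc (arc_of_proof e).

Definition ncrossings := size (crossings D).

Definition nth_crossing (k : 'I_ncrossings) : crossing arc :=
  map_crossing arc_of (tnth (in_tuple (crossings D)) k).

End Arcs.

(** * Colorings *)

Section Colorings.
Variables (X : finQuandleType) (D : diagram).

Record coloring := Coloring {
  color :> {ffun arc D -> X};
  _ : [forall k, let c := nth_crossing k in
        color (under_left c) == color (under_right c) ▷ color (over_in c)]
}.
HB.instance Definition _ := [isSub for color].
HB.instance Definition _ := [Finite of coloring by <:].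

Lemma end_coloring_proof (f : quandle_end X) (C : coloring) :
  let C' := [ffun a => f (C a)] in
  [forall k, let c := nth_crossing k in
    C' (under_left c) == C' (under_right c) ▷ C' (over_in c)].
Proof.
case: C => C /= /forallP hC; apply/forallP => k /=; rewrite !ffunE -end_funM.
exact/eqP/congr1/eqP/hC.
Qed.

Definition end_coloring (f : quandle_end X) (C : coloring) : coloring :=
  Coloring (end_coloring_proof f C).

End Colorings.

Local Open Scope ring_scope.

(** * Quandle modules and the module matrix *)

Definition invertible (R : comPzRingType) (u : R) := exists v, u * v = 1.

Record quandle_module (X : finQuandleType) (R : comPzRingType)
    (t s : X -> X -> R) : Prop := QuandleModule {
  qmod_unit : forall x y, invertible (t x y);
  qmod_diag : forall x, t x x + s x x = 1;
  qmod_tt : forall x y z,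
    t (x ▷ y) z * t x y = t (x ▷ z) (y ▷ z) * t x z;
  qmod_ts : forall x y z,
    t (x ▷ y) z * s x y = s (x ▷ z) (y ▷ z) * t y z;
  qmod_ss : forall x y z,
    s (x ▷ y) z = t (x ▷ z) (y ▷ z) * s x z + s (x ▷ z) (y ▷ z) * s y z
}.

(** The row of a crossing is that of the equation c - t a - s b = 0; the
  coefficients of arcs that occur several times at the crossing add up. *)
Definition module_matrix (X : finQuandleType) (R : comPzRingType)
    (t s : X -> X -> R) (D : diagram) (C : coloring X D) :
    'M[R]_(ncrossings D, #|{: arc D}|) :=
  \matrix_(k, j)
    let c := nth_crossing k in
    let x := C (under_right c) in
    let y := C (over_in c) in
    let a := enum_val j in
    (under_left c == a)%:R - t x y * (under_right c == a)%:R
      - s x y * (over_in c == a)%:R.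

Section Kernel.
Variables (R : comPzRingType) (m n : nat) (M : 'M[R]_(m, n)).

Definition ker_pred : {pred 'cV[R]_n} := [pred v | M *m v == 0].

Lemma ker_submod_closed : submod_closed ker_pred.
Proof.
split=> [|a u v]; first by rewrite inE mulmx0.
by rewrite !inE => /eqP hu /eqP hv; rewrite mulmxDr -scalemxAr hu hv scaler0 addr0.
Qed.
HB.instance Definition _ :=
  GRing.isSubmodClosed.Build R 'cV[R]_n ker_pred ker_submod_closed.

Record ker := Ker { ker_val :> 'cV[R]_n; _ : ker_val \in ker_pred }.
HB.instance Definition _ := [isSub for ker_val].
HB.instance Definition _ := [Choice of ker by <:].
HB.instance Definition _ := [SubChoice_isSubLmodule of ker by <:].

End Kernel.

Definition free_summand (R : comPzRingType) (N : lmodType R) (r : nat) :=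
  exists (T : lmodType R) (g : {linear N -> ('rV[R]_r * T)%type}), bijective g.

(** The default value 0 is not used for the kernel of a matrix over a nonzero
  ring: such an N embeds in a finite free module, which bounds r. *)
Definition free_rank (R : comPzRingType) (N : lmodType R) : nat :=
  xget 0%N (fun r => free_summand N r /\
                     forall r', free_summand N r' -> (r' <= r)%N).

Definition module_size (R : comPzRingType) (N : lmodType R) : nat :=
  if `[< finite_set [set: R]%classic >]
  then #|` fset_set [set: N]%classic|%fset else free_rank N.

(** * Weighted quivers *)

Record weighted_quiver := WeightedQuiver {
  vertex : finType;
  arrow : finType;
  source : arrow -> vertex;
  target : arrow -> vertex;
  weight : vertex -> nat
}.

Definition quiver_iso (Q Q' : weighted_quiver) : Prop :=
  exists (phi : vertex Q -> vertex Q') (psi : arrow Q -> arrow Q'),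
    [/\ bijective phi, bijective psi,
        forall e, source (psi e) = phi (source e),
        forall e, target (psi e) = phi (target e)
      & forall v, weight (phi v) = weight v].

(** An edge is a pair made of its source and the endomorphism in [S]. *)
Definition quandle_module_quiver (X : finQuandleType) (S : {set quandle_end X})
    (R : comPzRingType) (t s : X -> X -> R) (D : diagram) : weighted_quiver :=
  @WeightedQuiver (coloring X D) (coloring X D * {f | f \in S})%type
    (fun e => e.1)
    (fun e => end_coloring (val e.2) e.1)
    (fun C => module_size (ker (module_matrix t s C))).

(* Main.v *)
Require Import Defs.
From mathcomp Require Import all_boot all_algebra.
From HB Require Import structures.
From mathcomp Require Import finmap boolp classical_sets cardinality.
(* Again, because [arc] must not denote the one of [path]. *)
Require Import Defs.

(**
A coloring together with a solution of its module equations is the same thing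
as a coloring by the quandle X * R with
(x, a) ▷ (y, b) = (x ▷ y, t_{x,y} a + s_{x,y} b): the axioms of a quandle module
say exactly that this is a quandle.  So everything reduces to the classical
fact that, for an arbitrary quandle, a coloring is determined by its values on
the edges that a Reidemeister move leaves alone, and that such values extend
over one side of the move iff they extend over the other.  "Having the same
values on the untouched edges" is preserved by endomorphisms of X, by the
projection X * R -> X and by linear combinations in R, which makes the resulting
bijections compatible with the arrows and linear on the kernels.
*)

Set Implicit Arguments.
Unset Strict Implicit.
Unset Printing Implicit Defensive.

Import GRing.Theory.

(** * Colorings of codes by an arbitrary quandle *)

(** The carrier is an arbitrary type because the laws must also apply to X * R, which is infinite
    when R is. *)
Record quandle_law (Y : Type) (op : Y -> Y -> Y) : Prop := QuandleLaw {
  law_idem : forall x, op x x = x;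
  law_inj : forall y x x', op x y = op x' y -> x = x';
  law_surj : forall y x, exists z, op z y = x;
  law_dist : forall x y z, op (op x y) z = op (op x z) (op y z)
}.

Section Codes.
Variable L : eqType.
Implicit Types (K A B : code L) (c : crossing L) (l : L) (Z : seq L).

Definition crossing_halves c :=
  [:: (over_in c, true); (under_right c, positive c);
      (over_out c, false); (under_left c, ~~ positive c)].

Definition halves K : seq (L * bool) :=
  flatten (map crossing_halves (crossings K)) ++
  flatten [seq [:: (ab.1, true); (ab.2, false)] | ab <- bends K].

Definition labels K := unzip1 (halves K).

(** For labels in an infinite type such as [nat], this and [uniq (halves K)] are what remains of
    well-formedness. *)
Definition balanced K := forall l b, (l, b) \in halves K -> (l, ~~ b) \in halves K.

Definition code_cat A B :=
  Code (crossings A ++ crossings B) (bends A ++ bends B).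

Lemma perm_halves_cat A B : perm_eq (halves (code_cat A B)) (halves A ++ halves B).
Proof. by rewrite /halves /= !map_cat !flatten_cat perm_catACA. Qed.

Lemma mem_labels_cat A B l :
  (l \in labels (code_cat A B)) = (l \in labels A) || (l \in labels B).
Proof. by rewrite (perm_mem (perm_map _ (perm_halves_cat A B))) map_cat mem_cat. Qed.

Lemma mem_labels K l b : (l, b) \in halves K -> l \in labels K.
Proof. by move=> h; apply/mapP; exists (l, b). Qed.

Lemma crossing_labels K c : c \in crossings K ->
  {subset [:: over_in c; under_right c; over_out c; under_left c] <= labels K}.
Proof.
move=> hc l hl; have /mapP[h hh ->] : l \in unzip1 (crossing_halves c) by [].
apply: map_f; rewrite mem_cat; apply/orP; left.
by apply/flatten_mapP; exists c.
Qed.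

Lemma bend_labels K ab : ab \in bends K ->
  {subset [:: ab.1; ab.2] <= labels K}.
Proof.
move=> hc l hl.
have /mapP[h hh ->] : l \in unzip1 [:: (ab.1, true); (ab.2, false)] by [].
apply: map_f; rewrite mem_cat; apply/orP; right.
by apply/flatten_mapP; exists ab.
Qed.

Section Colors.
Variables (Y : Type) (op : Y -> Y -> Y).
Implicit Type u : L -> Y.

(** Colors sit on edges, not on arcs: constancy along an arc becomes a local equation at each
    over-passage and each bend, so a move only affects the equations of its own tangle. *)
Definition colors_crossing c u :=
  u (over_in c) = u (over_out c)
  /\ u (under_left c) = op (u (under_right c)) (u (over_in c)).

Definition colors K u :=
  (forall c, c \in crossings K -> colors_crossing c u)
  /\ (forall ab, ab \in bends K -> u ab.1 = u ab.2).

Lemma colors_crossing_cons c cs bs u :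
  colors (Code (c :: cs) bs) u <-> colors_crossing c u /\ colors (Code cs bs) u.
Proof.
split=> [[hc hb]|[h [hc hb]]].
  by split; [apply: hc; rewrite /= mem_head |
             split=> // d hd; apply: hc; rewrite inE hd orbT].
by split=> // d; rewrite inE => /predU1P[->|/hc].
Qed.

Lemma colors_bend_cons a b cs bs u :
  colors (Code cs ((a, b) :: bs)) u <-> u a = u b /\ colors (Code cs bs) u.
Proof.
split=> [[hc hb]|[h [hc hb]]].
  split; first by apply: (hb (a, b)); rewrite /= mem_head.
  by split=> // d hd; apply: hb; rewrite inE hd orbT.
by split=> // d; rewrite inE => /predU1P[->|/hb].
Qed.

Lemma colors_nil u : colors (Code [::] [::]) u <-> True.
Proof. by []. Qed.

Lemma colors_cat A B u : colors (code_cat A B) u <-> colors A u /\ colors B u.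
Proof.
split=> [[hc hb]|[[hcA hbA] [hcB hbB]]].
  by split; split=> d hd; [apply: hc | apply: hb | apply: hc | apply: hb];
    rewrite mem_cat hd ?orbT.
by split=> d; rewrite mem_cat => /orP[]; auto.
Qed.

Lemma eq_colors K u u' : {in labels K, u =1 u'} -> colors K u -> colors K u'.
Proof.
move=> e [hc hb]; split=> [c cK|ab abK].
  have eu l : l \in [:: over_in c; under_right c; over_out c; under_left c] ->
    u l = u' l by move=> hl; apply/e/(crossing_labels cK).
  by have := hc c cK; rewrite /colors_crossing !eu // !inE eqxx ?orbT.
by rewrite -!e ?(hb ab abK) //; apply: (bend_labels abK);
  rewrite !inE eqxx ?orbT.
Qed.

Lemma colors_code_eq K K' u : code_eq K K' -> colors K u <-> colors K' u.
Proof.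
case/andP=> /perm_mem hc /perm_mem hb.
by split=> -[h h']; split=> d dK;
  (apply: h; rewrite ?hc // -hc) || (apply: h'; rewrite ?hb // -hb).
Qed.

Definition agree_off Z u u' := forall l, l \notin Z -> u l = u' l.

(** Uniqueness is restricted to the labels of [K'], since a coloring is a function on all of [L] and
    its values elsewhere are arbitrary. *)
Definition extends_uniquely Z K K' :=
  (forall u, colors K u -> exists2 u', colors K' u' & agree_off Z u u')
  /\ (forall u1 u2, colors K' u1 -> colors K' u2 -> agree_off Z u1 u2 ->
      {in labels K', u1 =1 u2}).

End Colors.

(* Z contains the labels that the move creates, or that it keeps with another
   color, like the two lower sides of the triangle in R3. *)
Definition linked K K' := exists Z : seq L,
  (forall l, l \notin Z -> (l \in labels K) = (l \in labels K')) /\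
  forall (Y : Type) (op : Y -> Y -> Y), quandle_law op ->
    extends_uniquely op Z K K' /\ extends_uniquely op Z K' K.

Lemma linked_refl K : linked K K.
Proof.
exists [::]; split=> // Y op hop.
have hK : extends_uniquely op [::] K K.
  by split=> [u hu|u1 u2 _ _ h l _]; [exists u | apply: h].
by [].
Qed.

Lemma linked_sym K K' : linked K K' -> linked K' K.
Proof.
case=> Z [hl hZ]; exists Z; split=> [l /hl //|Y op hop].
by have [] := hZ Y op hop.
Qed.

(** Locality: [B] does not see the labels in [Z], so its equations survive the change of coloring
    inside the tangle. *)
Lemma extends_uniquely_cat Y (op : Y -> Y -> Y) Z A A' B :
    (forall l, l \in Z -> l \notin labels B) ->
  extends_uniquely op Z A A' ->
  extends_uniquely op Z (code_cat A B) (code_cat A' B).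
Proof.
move=> hZB [hex huniq].
have hBZ l : l \in labels B -> l \notin Z by apply: contraL; apply: hZB.
split=> [u /colors_cat[/hex[u' hu' uu'] huB]|u1 u2].
  exists u' => //; apply/colors_cat; split=> //.
  by apply: eq_colors huB => l /hBZ/uu'.
move=> /colors_cat[h1 _] /colors_cat[h2 _] h12 l; rewrite mem_labels_cat.
by case/orP=> [|/hBZ/h12]; first exact: huniq.
Qed.

(* A label both of whose halves lie in the tangle A' does not occur outside it. *)
Lemma linked_local Z A A' B :
    uniq (halves (code_cat A' B)) ->
    (uniq (halves A') -> [/\ forall l b, l \in Z -> (l, b) \in halves A',
      forall l, l \notin Z -> (l \in labels A) = (l \in labels A')
      & forall (Y : Type) (op : Y -> Y -> Y), quandle_law op ->
        extends_uniquely op Z A A' /\ extends_uniquely op Z A' A]) ->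
  linked (code_cat A B) (code_cat A' B).
Proof.
rewrite (perm_uniq (perm_halves_cat _ _)) cat_uniq => /and3P[hA' hAB _].
case/(_ hA')=> hZ hl hYop.
have hZB l : l \in Z -> l \notin labels B.
  move=> lZ; apply: contra hAB => /mapP[[l' b] hb /= el].
  by rewrite el in lZ; apply/hasP; exists (l', b) => //; apply: hZ.
exists Z; split=> [l lZ|Y op /hYop[h h']]; first by rewrite !mem_labels_cat hl.
by split; apply: extends_uniquely_cat.
Qed.


Definition upd Y (u : L -> Y) l y := fun k => if k == l then y else u k.

Lemma upd_same Y (u : L -> Y) l y : upd u l y l = y.
Proof. by rewrite /upd eqxx. Qed.

Lemma upd_other Y (u : L -> Y) l y k : k != l -> upd u l y k = u k.
Proof. by rewrite /upd => /negbTE ->. Qed.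


Lemma extends_uniquely_fresh Y (op : Y -> Y -> Y) Z K K' :
    (forall u, colors op K u -> exists2 u', colors op K' u' & agree_off Z u u') ->
    (forall u1 u2, colors op K' u1 -> colors op K' u2 -> agree_off Z u1 u2 ->
      forall l, l \in Z -> l \in labels K' -> u1 l = u2 l) ->
  extends_uniquely op Z K K'.
Proof.
move=> hex huniq; split=> // u1 u2 h1 h2 h12 l lK.
by case: (boolP (l \in Z)) => [lZ|/h12 //]; apply: huniq.
Qed.

End Codes.

(** * Automation: distinctness of labels and color equations of a concrete tangle *)

Ltac split_distinct H :=
  rewrite /halves /= ?inE ?xpair_eqE /= ?(andbT, andbF, orbF, orbT) ?negb_or in H;
  repeat match goal with
  | h : is_true (_ && _) |- _ =>
      let h1 := fresh "ne" in let h2 := fresh "ne" in case/andP: h => h1 h2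
  end.

Ltac by_distinct :=
  rewrite ?inE ?negb_or; repeat (apply/andP; split);
  solve [assumption | rewrite eq_sym; assumption].

Ltac simpl_upd :=
  repeat (rewrite upd_same || (rewrite upd_other; [ | by_distinct])).

Ltac fresh_halves :=
  let l := fresh in let b := fresh in
  move=> l b; rewrite !inE => ?;
  repeat match goal with h : is_true (_ || _) |- _ => case/orP: h => h end;
  match goal with h : is_true (l == _) |- _ => rewrite (eqP h) end;
  case: b; rewrite ?xpair_eqE ?eqxx /= ?orbT.

Ltac same_labels :=
  let l := fresh "l" in
  move=> l; rewrite /labels /= !inE ?negb_or;
  repeat match goal with |- context [l == ?x] => case: (l == x) => //= end.

Ltac unfold_colors :=
  rewrite !(colors_crossing_cons, colors_bend_cons, colors_nil) /colors_crossing /=.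

Ltac by_agree :=
  let l := fresh "l" in let h := fresh "h" in
  move=> l h; rewrite ?inE ?negb_or in h;
  repeat match goal with h : is_true (_ && _) |- _ => case/andP: h => ? ? end;
  simpl_upd; done.

Ltac not_label :=
  rewrite /labels /= ?inE;
  repeat match goal with |- context [?x == ?y] =>
    let h := fresh in have h : x != y; [by_distinct | rewrite (negbTE h) {h}] end;
  done.

Ltac split_tangles H :=
  split_distinct H;
  split; [by fresh_halves | by same_labels | move=> Y op hop];
  split; apply: extends_uniquely_fresh.

Ltac each_label :=
  let h := fresh in move=> ? h; rewrite ?inE in h;
  repeat match goal with h : is_true (_ || _) |- _ => case/orP: h => h end;
  match goal with h : is_true (_ == _) |- _ => rewrite (eqP h) end.

Ltac by_congruence := unfold_colors; simpl_upd; intuition congruence.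

(** * The first and second Reidemeister moves *)

Section Kinks.
Variables (L : eqType) (a b g : L).

Definition kinks := [:: Crossing true a g g b; Crossing true g a b g;
                        Crossing false a b g g; Crossing false g g b a].

(** The loop [g] gives the over-strand and one under-edge the same color. If that under-edge is the
    right one, idempotence yields the color of the left one; if it is the left one, the action of
    the over-color has to be cancelled as well. *)
Lemma colors_kink c Y (op : Y -> Y -> Y) u : c \in kinks -> quandle_law op ->
  colors_crossing op c u <-> u a = u b /\ u g = u a.
Proof.
move=> hc hop; rewrite !inE in hc; have idem := law_idem hop.
case/or4P: hc => /eqP->; rewrite /colors_crossing /=; split=> -[h1 h2].
- by rewrite h2 -h1 idem.
- by rewrite h2 -h1 idem.
- have e : u g = u a by apply: (law_inj hop (y := u g)); rewrite idem.
  by rewrite -e.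
- by rewrite h2 -h1 idem.
- have e : u a = u b by apply: (law_inj hop (y := u a)); rewrite idem -h2.
  by split=> //; rewrite h1.
- by rewrite h2 -h1 idem.
- by rewrite h2 -h1 idem.
- by rewrite h2 -h1 idem.
Qed.

Lemma extends_uniquely_kink c Y (op : Y -> Y -> Y) :
    c \in kinks -> quandle_law op -> a != g -> b != g ->
  let A := Code [::] [:: (a, b)] in let A' := Code [:: c] [::] in
  extends_uniquely op [:: g] A A' /\ extends_uniquely op [:: g] A' A.
Proof.
move=> hc hop nag nbg A A'.
have colA u : colors op A u <-> u a = u b.
  by rewrite colors_bend_cons colors_nil; intuition.
have colA' u : colors op A' u <-> u a = u b /\ u g = u a.
  by rewrite colors_crossing_cons colors_nil colors_kink //; intuition.
split; apply: extends_uniquely_fresh;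
  [move=> u /colA e | move=> u1 u2 /colA'[_ g1] /colA'[_ g2] h |
   move=> u /colA'[e _] | move=> u1 u2 _ _ _].
- exists (upd u g (u a)); last by by_agree.
  by apply/colA'; simpl_upd.
- by each_label => _; rewrite g1 g2; apply: h; by_distinct.
- by exists u => //; apply/colA.
- by each_label; rewrite /A; not_label.
Qed.

Lemma linked_R1 c cs bs : c \in kinks -> uniq (halves (Code (c :: cs) bs)) ->
  linked (Code cs ((a, b) :: bs)) (Code (c :: cs) bs).
Proof.
move=> hc hu.
apply: (@linked_local _ [:: g] (Code [::] [:: (a, b)]) (Code [:: c] [::])
  (Code cs bs)) => // {hu}.
have := hc; rewrite !inE => /or4P[]/eqP ec; rewrite {}ec in hc * => hK;
  split_distinct hK; (split; [by fresh_halves | by same_labels |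
    by move=> Y op hop; apply: extends_uniquely_kink => //; by_distinct]).
Qed.

End Kinks.

(** Here [h] is the left under-edge of both crossings: its color is computed from those of [b] and
    [a], and in the other direction injectivity of the action forces [b] and [b'] to agree. *)
Lemma linked_R2_left (L : eqType) p (a a' g b b' h : L) cs bs :
    uniq (halves (Code [:: Crossing p a b g h,
                           Crossing (~~ p) g b' a' h & cs] bs)) ->
  linked (Code cs [:: (a, a'), orient_bend p b b' & bs])
         (Code [:: Crossing p a b g h, Crossing (~~ p) g b' a' h & cs] bs).
Proof.
move=> hu.
apply: (@linked_local _ [:: g; h]
  (Code [::] [:: (a, a'); orient_bend p b b'])
  (Code [:: Crossing p a b g h; Crossing (~~ p) g b' a' h] [::])
  (Code cs bs)) => // {hu}.
case: p => hK; (split_tangles hK => [u|u1 u2|u|u1 u2]; unfold_colors;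
  [ move=> [e [e' _]]; exists (upd (upd u g (u a)) h (op (u b) (u a)));
      [by_congruence | by_agree]
  | move=> ? ? e;
    have ea : u1 a = u2 a by [apply: e; by_distinct];
    have eb : u1 b = u2 b by [apply: e; by_distinct];
    each_label; intuition congruence
  | move=> hu; exists u => //;
    have e : u b = u b' by [apply: (law_inj hop (y := u a)); intuition congruence];
    by_congruence
  | by move=> _ _ _; each_label; not_label]).
Qed.

(** Here [h] is the right under-edge of both crossings: its color exists by surjectivity of the
    action and is unique by injectivity, while [b] and [b'] agree at once. *)
Lemma linked_R2_right (L : eqType) p (a a' g b b' h : L) cs bs :
    uniq (halves (Code [:: Crossing p a h g b,
                           Crossing (~~ p) g h a' b' & cs] bs)) ->
  linked (Code cs [:: (a, a'), orient_bend p b' b & bs])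
         (Code [:: Crossing p a h g b, Crossing (~~ p) g h a' b' & cs] bs).
Proof.
move=> hu.
apply: (@linked_local _ [:: g; h]
  (Code [::] [:: (a, a'); orient_bend p b' b])
  (Code [:: Crossing p a h g b; Crossing (~~ p) g h a' b'] [::])
  (Code cs bs)) => // {hu}.
case: p => hK; (split_tangles hK => [u|u1 u2|u|u1 u2]; unfold_colors;
  [ move=> [e [e' _]]; have [z hz] := law_surj hop (u a) (u b);
    exists (upd (upd u g (u a)) h z); [by_congruence | by_agree]
  | move=> ? ? e;
    have ea : u1 a = u2 a by [apply: e; by_distinct];
    have eb : u1 b = u2 b by [apply: e; by_distinct];
    have eh : u1 h = u2 h by
      [apply: (law_inj hop (y := u1 a)); intuition congruence];
    each_label; intuition congruence
  | move=> hu; exists u => //; by_congruence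
  | by move=> _ _ _; each_label; not_label]).
Qed.

(** * The third Reidemeister move *)

Section Slide.
Variables (L : eqType) (t0 t1 t2 mS m mN bS b bN : L) (A A' : code L).
Variables (Y : Type) (op : Y -> Y -> Y).
Hypothesis hop : quandle_law op.
Hypothesis m_neq_b : m != b.
Hypothesis outer : all (fun l => l \notin [:: m; b]) [:: t0; t1; t2; mS; mN; bS; bN].

(** The southern end of the bottom strand lies to the right of the middle strand. Only the inner
    edges [m] and [b] change color, and the two values of [bN] agree by self-distributivity applied
    to [bS], [mS], [t0]. *)
Lemma extends_uniquely_slide_parallel :
    (forall u, colors op A u <-> [/\ u t1 = u t0 /\ u t2 = u t0,
      u m = op (u mS) (u t0), u b = op (u bS) (u t0), u mN = u m
      & u bN = op (u b) (u m)]) ->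
    (forall u, colors op A' u <-> [/\ u t1 = u t0 /\ u t2 = u t0,
      u mN = op (u m) (u t0), u bN = op (u b) (u t0), u m = u mS
      & u b = op (u bS) (u mS)]) ->
  extends_uniquely op [:: m; b] A A' /\ extends_uniquely op [:: m; b] A' A.
Proof.
move=> colA colA'; have H := outer; split_distinct H.
split; apply: extends_uniquely_fresh;
  [move=> u /colA[[e1 e2] e3 e4 e5 e6]
  |move=> u1 u2 /colA'[[e1 e2] e3 e4 e5 e6] /colA'[[d1 d2] d3 d4 d5 d6] h
  |move=> u /colA'[[e1 e2] e3 e4 e5 e6]
  |move=> u1 u2 /colA[[e1 e2] e3 e4 e5 e6] /colA[[d1 d2] d3 d4 d5 d6] h].
- exists (upd (upd u m (u mS)) b (op (u bS) (u mS))); last by by_agree.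
  apply/colA'; simpl_upd; split=> //; first congruence.
  by rewrite e6 e4 e3 -(law_dist hop).
- have hm : u1 mS = u2 mS by apply: h; by_distinct.
  have hb : u1 bS = u2 bS by apply: h; by_distinct.
  each_label; congruence.
- exists (upd (upd u m (u mN)) b (op (u bS) (u t0))); last by by_agree.
  apply/colA; simpl_upd; split=> //; first congruence.
  by rewrite e4 e6 e3 e5 -(law_dist hop).
- have ht : u1 t0 = u2 t0 by apply: h; by_distinct.
  have hm : u1 mS = u2 mS by apply: h; by_distinct.
  have hb : u1 bS = u2 bS by apply: h; by_distinct.
  each_label; congruence.
Qed.

(** The southern end of the bottom strand lies to the left of the middle strand, so some colors are
    given only implicitly, as preimages under the action. *)
Lemma extends_uniquely_slide_antiparallel :
    (forall u, colors op A u <-> [/\ u t1 = u t0 /\ u t2 = u t0,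
      u m = op (u mS) (u t0), u b = op (u bS) (u t0), u mN = u m
      & u b = op (u bN) (u mN)]) ->
    (forall u, colors op A' u <-> [/\ u t1 = u t0 /\ u t2 = u t0,
      u mN = op (u m) (u t0), u bN = op (u b) (u t0), u m = u mS
      & u bS = op (u b) (u m)]) ->
  extends_uniquely op [:: m; b] A A' /\ extends_uniquely op [:: m; b] A' A.
Proof.
move=> colA colA'; have H := outer; split_distinct H.
split; apply: extends_uniquely_fresh;
  [move=> u /colA[[e1 e2] e3 e4 e5 e6]
  |move=> u1 u2 /colA'[[e1 e2] e3 e4 e5 e6] /colA'[[d1 d2] d3 d4 d5 d6] h
  |move=> u /colA'[[e1 e2] e3 e4 e5 e6]
  |move=> u1 u2 /colA[[e1 e2] e3 e4 e5 e6] /colA[[d1 d2] d3 d4 d5 d6] h].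
(* After the slide, [b] must be a preimage of the color of [bS] under the action of [mS]. *)
- have [z hz] := law_surj hop (u mS) (u bS).
  exists (upd (upd u m (u mS)) b z); last by by_agree.
  apply/colA'; simpl_upd; split=> //; first congruence.
  (* The equation for [bN] becomes distributivity once both sides are acted on by the color of
     [mN]. *)
  apply: (law_inj hop (y := u mN)).
  by rewrite -e6 e4 -hz e5 e3 -(law_dist hop).
- have hm : u1 mS = u2 mS by apply: h; by_distinct.
  have hb : u1 bS = u2 bS by apply: h; by_distinct.
  have e : u1 b = u2 b by apply: (law_inj hop (y := u1 mS)); congruence.
  each_label; congruence.
- exists (upd (upd u m (u mN)) b (op (u bS) (u t0))); last by by_agree.
  apply/colA; simpl_upd; split=> //; first congruence.
  by rewrite e6 e4 e3 -(law_dist hop).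
- have ht : u1 t0 = u2 t0 by apply: h; by_distinct.
  have hm : u1 mS = u2 mS by apply: h; by_distinct.
  have hb : u1 bS = u2 bS by apply: h; by_distinct.
  each_label; congruence.
Qed.

End Slide.

Ltac slide lem :=
  let H := fresh in move=> H; split_distinct H;
  split; [by fresh_halves | by same_labels | move=> ? ? ?];
  apply: lem;
  [ done | by_distinct | rewrite /=; by_distinct
  | move=> ?; unfold_colors; split; [split | case]; intuition congruence
  | move=> ?; unfold_colors; split; [split | case]; intuition congruence].

(** Color equations ignore the direction of the under-strand, so [pm] alone decides on which side of
    the middle strand the bottom one starts, hence which system of equations arises. *)
Lemma linked_R3_west (L : eqType) (pm pb : bool) (t0 t1 t2 mS m mN bS b bN : L) cs bs :
    let K := Code [:: Crossing pm t0 mS t1 m, Crossing pb t1 bS t2 b,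
                      orient_over pm pb m b mN bN & cs] bs in
    let K' := Code [:: Crossing pb t0 b t1 bN, Crossing pm t1 m t2 mN,
                       orient_over pm pb mS bS m b & cs] bs in
  uniq (halves K') -> linked K K'.
Proof.
move=> K K' hu.
apply: (@linked_local _ [:: m; b]
  (Code [:: Crossing pm t0 mS t1 m; Crossing pb t1 bS t2 b;
            orient_over pm pb m b mN bN] [::])
  (Code [:: Crossing pb t0 b t1 bN; Crossing pm t1 m t2 mN;
            orient_over pm pb mS bS m b] [::])
  (Code cs bs)) => // {K K' hu}.
case: pm.
- by case: pb; slide (@extends_uniquely_slide_parallel _ t0 t1 t2 mS m mN bS b bN).
by case: pb; slide (@extends_uniquely_slide_antiparallel _ t0 t1 t2 mS m mN bS b bN).
Qed.

(** With the middle strand on the other side of the bottom one, the two systems are exchanged. *)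
Lemma linked_R3_east (L : eqType) (pm pb : bool) (t0 t1 t2 mS m mN bS b bN : L) cs bs :
    let K := Code [:: Crossing pb t0 bS t1 b, Crossing pm t1 mS t2 m,
                      orient_over pm (~~ pb) m bN mN b & cs] bs in
    let K' := Code [:: Crossing pm t0 m t1 mN, Crossing pb t1 b t2 bN,
                       orient_over pm (~~ pb) mS b m bS & cs] bs in
  uniq (halves K') -> linked K K'.
Proof.
move=> K K' hu.
apply: (@linked_local _ [:: m; b]
  (Code [:: Crossing pb t0 bS t1 b; Crossing pm t1 mS t2 m;
            orient_over pm (~~ pb) m bN mN b] [::])
  (Code [:: Crossing pm t0 m t1 mN; Crossing pb t1 b t2 bN;
            orient_over pm (~~ pb) mS b m bS] [::])
  (Code cs bs)) => // {K K' hu}.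
case: pm.
- by case: pb; slide (@extends_uniquely_slide_antiparallel _ t0 t1 t2 mS m mN bS b bN).
by case: pb; slide (@extends_uniquely_slide_parallel _ t0 t1 t2 mS m mN bS b bN).
Qed.

(** * From codes to diagrams *)

Section MapCode.
Variables (L L' : eqType) (f : L -> L') (K : code L).

Lemma halves_map : halves (map_code f K) = [seq (f h.1, h.2) | h <- halves K].
Proof.
by rewrite /halves map_cat !map_flatten -!map_comp; congr (flatten _ ++ flatten _).
Qed.

Lemma labels_map : labels (map_code f K) = map f (labels K).
Proof. by rewrite /labels halves_map /unzip1 -!map_comp. Qed.

Lemma colors_map Y (op : Y -> Y -> Y) u :
  colors op (map_code f K) u <-> colors op K (u \o f).
Proof.
split=> -[hc hb]; split=> [c cK|ab abK].
- exact: hc _ (map_f _ cK).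
- exact: hb _ (map_f _ abK).
- by case/mapP: cK => d dK ->; apply: hc.
- by case/mapP: abK => d dK ->; apply: hb.
Qed.

End MapCode.

Lemma perm_halves (L : eqType) (K K' : code L) :
  code_eq K K' -> perm_eq (halves K) (halves K').
Proof.
by case/andP=> hc hb; apply: perm_cat; apply: perm_flatten; apply: perm_map.
Qed.

Lemma linked_subdivision (L : eqType) (a b : L) cs bs :
    a != b -> balanced (Code cs ((a, b) :: bs)) ->
  linked (map_code (fun e => if e == b then a else e) (Code cs bs))
         (Code cs ((a, b) :: bs)).
Proof.
move=> nab hbal; pose sigma e := if e == b then a else e.
have memK' h : (h \in halves (Code cs ((a, b) :: bs))) =
    (h \in [:: (a, true); (b, false)]) || (h \in halves (Code cs bs)).
  rewrite -mem_cat; apply: perm_mem.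
  exact: (perm_halves_cat (Code [::] [:: (a, b)]) (Code cs bs)).
(* The bend uses only the terminal half of [a]; by balance its initial half lies at another vertex,
   so [a] is still a label once the bend is removed. *)
have aB : a \in labels (Code cs bs).
  apply: (@mem_labels _ _ _ false).
  have := hbal a true; rewrite !memK' !inE !xpair_eqE !eqxx (negbTE nab) /=.
  by apply.
exists [:: b]; split=> [l|Y op hop].
  rewrite inE labels_map => nlb.
  rewrite [RHS](mem_labels_cat (Code [::] [:: (a, b)]) (Code cs bs)).
  apply/mapP/idP => [[k kB]|]; rewrite /sigma.
    by case: (k == b) => ->; rewrite ?aB ?kB orbT.
  rewrite !inE (negbTE nlb) orbF => /predU1P[->|lB].
    by exists a; rewrite // (negbTE nab).
  by exists l; rewrite // (negbTE nlb).
split; apply: extends_uniquely_fresh; [move=> u | move=> u1 u2 | move=> u | move=> u1 u2].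
- move/colors_map => hu; exists (u \o sigma).
    by apply/colors_bend_cons; rewrite /= /sigma eqxx (negbTE nab).
  by move=> l; rewrite inE /= /sigma => /negbTE ->.
- move=> /colors_bend_cons[h1 _] /colors_bend_cons[h2 _] h l.
  by rewrite inE => /eqP-> _; rewrite -h1 -h2 h // inE.
- move=> /colors_bend_cons[hab hu]; exists u => //; apply/colors_map.
  by apply: eq_colors hu => l _ /=; case: eqP => // ->.
- move=> _ _ _ l; rewrite inE labels_map => /eqP-> /mapP[k _].
  by case: (k =P b) => [_ eb|nkb /esym//]; rewrite eb eqxx in nab.
Qed.

Lemma move_linked (L : eqType) (K K' : code L) :
  uniq (halves K') -> balanced K' -> move K K' -> linked K K'.
Proof.
move=> hu hb m; case: m hu hb => {K K'}.
- by move=> *; apply: linked_subdivision.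
- by move=> a b g *; apply: (linked_R1 (g := g)) => //; rewrite !inE eqxx.
- by move=> a b g *; apply: (linked_R1 (g := g)) => //; rewrite !inE eqxx ?orbT.
- by move=> a b g *; apply: (linked_R1 (g := g)) => //; rewrite !inE eqxx ?orbT.
- by move=> a b g *; apply: (linked_R1 (g := g)) => //; rewrite !inE eqxx ?orbT.
- by move=> *; apply: linked_R2_left.
- by move=> *; apply: linked_R2_right.
- by move=> *; apply: linked_R3_west.
- by move=> *; apply: linked_R3_east.
Qed.

(* The two colorings of K' by the trivial quandle on bool that are constant on
   its labels would otherwise extend the same coloring of K. *)
Lemma linked_nil (L : eqType) (K K' : code L) :
  linked K K' -> labels K = [::] -> labels K' = [::].
Proof.
case=> Z [hl hZ] K0; pose op (x y : bool) := x.
have hop : quandle_law op by split=> // y x; exists x.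
have [[_ huniq] _] := hZ bool op hop.
have cst b : colors op K' (fun=> b) by [].
case E: (labels K') => [//|l s].
have hin : colors op K' (fun l => l \notin labels K').
  by apply: eq_colors (cst false) => k ->.
have agr : agree_off Z (fun l => l \notin labels K') (fun=> true).
  by move=> k kZ; rewrite -hl // K0.
by have := huniq _ _ hin (cst true) agr l; rewrite E mem_head => /(_ isT).
Qed.

(** * Arc colorings as edge colorings *)

Section ArcColors.
Variables (D : diagram) (Y : Type) (op : Y -> Y -> Y).

Lemma arc_of_surj (a : arc D) : exists e, arc_of e == a.
Proof.
by case: a => A hA; have /existsP[e /eqP eA] := hA; exists e; apply/eqP/val_inj.
Qed.

Lemma joined_arc_of (e e' : edge D) : joined e e' -> arc_of e = arc_of e'.
Proof.
move=> ee'; apply/val_inj/setP => g /=; rewrite !inE.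
apply: same_connect; last by apply: connect1; rewrite /= ee'.
by apply: sym_connect_sym => x y /=; rewrite orbC.
Qed.

Definition arc_colors (w : arc D -> Y) := forall c, c \in crossings D ->
  w (arc_of (under_left c)) = op (w (arc_of (under_right c))) (w (arc_of (over_in c))).

Lemma arc_colorsE w : arc_colors w <-> colors op D (w \o @arc_of D).
Proof.
split=> [hw|[hc _] c /hc[]//]; split=> [c cD|[a b] abD].
  split; last exact: hw.
  congr w; apply: joined_arc_of; apply/orP; right.
  by apply/hasP; exists c; rewrite ?eqxx.
by congr w; apply: joined_arc_of; apply/orP; left.
Qed.

(** An edge coloring is constant along [joined], hence on each arc class, so it descends to arcs by
    evaluation at a chosen edge. *)
Lemma colors_arc u : colors op D u ->
  exists2 w, arc_colors w & forall e, w (arc_of e) = u e.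
Proof.
move=> hu; have [hc hb] := hu.
have hj e e' : joined e e' -> u e = u e'.
  case/orP=> [/hb //|/hasP[c cD /andP[/eqP<- /eqP<-]]].
  by have [] := hc c cD.
have hconn e e' : arc_of e = arc_of e' -> u e = u e'.
  move=> eqe; have : e' \in arc_set (arc_of e) by rewrite eqe inE connect0.
  rewrite inE => /connectP[p]; elim: p e {eqe} => [|g p IH] e /=.
    by move=> _ ->.
  case/andP=> /orP[/hj->|/hj<-] hp he'; exact: IH.
pose w a := u (xchoose (arc_of_surj a)).
have wE e : w (arc_of e) = u e by apply/hconn/eqP/(xchooseP (arc_of_surj _)).
exists w => //; apply/arc_colorsE; apply: eq_colors hu => e _; exact/esym/wE.
Qed.

End ArcColors.

Lemma well_formed_halves (D : diagram) : perm_eq (halves D) (enum {: edge D * bool}).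
Proof. by case: D => E K hK hp; have := hK; rewrite /well_formed flatten_cat. Qed.

(** * Passing between a diagram and its code on natural numbers *)

Section Encoding.
Variables (D : diagram) (K : code nat) (f : edge D -> nat).
Hypotheses (f_inj : injective f) (fDK : code_eq (map_code f D) K).

Lemma perm_halves_encoding :
  perm_eq (halves K) [seq (f h.1, h.2) | h <- enum {: edge D * bool}].
Proof.
rewrite perm_sym (perm_trans _ (perm_halves fDK)) // halves_map.
by rewrite perm_map // perm_sym well_formed_halves.
Qed.

Lemma mem_halves_encoding l b :
  reflect (exists e, f e = l) ((l, b) \in halves K).
Proof.
rewrite (perm_mem perm_halves_encoding).
apply: (iffP mapP) => [[[e b'] _ [-> _]]|[e <-]]; first by exists e.
by exists (e, b); rewrite ?mem_enum.
Qed.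

Lemma mem_labels_encoding l : reflect (exists e, f e = l) (l \in labels K).
Proof.
apply: (iffP mapP) => [[[k b] /mem_halves_encoding he /= ->] //|he].
by exists (l, true) => //; apply/mem_halves_encoding.
Qed.

Lemma uniq_halves_encoding : uniq (halves K).
Proof.
rewrite (perm_uniq perm_halves_encoding) map_inj_uniq ?enum_uniq //.
by move=> [e b] [e' b'] [/f_inj-> ->].
Qed.

Lemma balanced_encoding : balanced K.
Proof. by move=> l b /mem_halves_encoding h; apply/mem_halves_encoding. Qed.

(** Colorings of a code are defined on all of [nat], so labels that name no edge need a default
    color [y0]. *)
Definition extend Y (v : edge D -> Y) (y0 : Y) (l : nat) : Y :=
  if [pick e | f e == l] is Some e then v e else y0.

Lemma extendE Y (v : edge D -> Y) y0 e : extend v y0 (f e) = v e.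
Proof.
by rewrite /extend; case: pickP => [e' /eqP/f_inj-> //|/(_ e)]; rewrite eqxx.
Qed.

Lemma colors_encoding Y (op : Y -> Y -> Y) u :
  colors op K u <-> colors op D (u \o f).
Proof. by rewrite -(colors_code_eq _ _ fDK) colors_map. Qed.

Lemma colors_extend Y (op : Y -> Y -> Y) w y0 :
  arc_colors op w -> colors op K (extend (w \o @arc_of D) y0).
Proof.
move/arc_colorsE => hw; apply/colors_encoding.
by apply: eq_colors hw => e _; rewrite /= extendE.
Qed.

End Encoding.

(** The counterpart of [agree_off] for two diagrams. Arcs may split or merge under a move, so colors
    are compared edge by edge. *)
Definition compatible (D D' : diagram) (f : edge D -> nat) (f' : edge D' -> nat)
    (Z : seq nat) Y (w : arc D -> Y) (w' : arc D' -> Y) :=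
  forall e e', f e = f' e' -> f e \notin Z -> w (arc_of e) = w' (arc_of e').

Lemma compatible_sym D D' f f' Z Y (w : arc D -> Y) (w' : arc D' -> Y) :
  compatible f f' Z w w' -> compatible f' f Z w' w.
Proof. by move=> h e' e ee' eZ; rewrite (h e e') // -ee'. Qed.

(** The same [f], [f'] and [Z] must serve all quandles at once: X and X * R are used together, one
    lying over the other. *)
Definition transfers (D D' : diagram) (f : edge D -> nat) (f' : edge D' -> nat)
    (Z : seq nat) := forall (Y : Type) (op : Y -> Y -> Y), quandle_law op ->
  (forall w : arc D -> Y, arc_colors op w ->
    exists2 w' : arc D' -> Y, arc_colors op w' & compatible f f' Z w w')
  /\ (forall (w : arc D -> Y) (w1 w2 : arc D' -> Y),
    arc_colors op w1 -> arc_colors op w2 ->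
    compatible f f' Z w w1 -> compatible f f' Z w w2 -> w1 =1 w2).

Lemma transfers_encoding (D D' : diagram) (K K' : code nat) f f' Z :
    injective f -> code_eq (map_code f D) K ->
    injective f' -> code_eq (map_code f' D') K' ->
    (forall l, l \notin Z -> l \in labels K' -> l \in labels K) ->
    (labels K = [::] -> labels K' = [::]) ->
    (forall (Y : Type) (op : Y -> Y -> Y), quandle_law op ->
      extends_uniquely op Z K K') ->
  transfers (D := D) (D' := D') f f' Z.
Proof.
move=> f_inj fDK f'_inj fDK' hl h0 hZ Y op /hZ[hex huniq].
split=> [w hw|w w1 w2 hw1 hw2 c1 c2 a].
  (* An edge of [D] supplies the default color. Without one, [labels K] is empty, hence so is
     [labels K'], and [D'] has no arc to color. *)
  case: (pickP [pred e : edge D | true]) => [e0 _|no_e].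
    have := colors_extend f_inj fDK (w (arc_of e0)) hw.
    case/hex=> u' /(colors_encoding fDK')/colors_arc[w' hw' w'E] agr.
    exists w' => // e e' ee' eZ.
    by rewrite w'E /= -ee' -agr // extendE.
  have no_arc (a : arc D') : False.
    have [e' _] := arc_of_surj a.
    have : f' e' \in labels K' by apply/(mem_labels_encoding fDK'); exists e'.
    rewrite h0 //; case E: (labels K) => [//|l s].
    have /(mem_labels_encoding fDK)[e _] : l \in labels K by rewrite E mem_head.
    by have := no_e e.
  by exists (fun a => False_rect _ (no_arc a)) => [c|e e']; case: no_arc (arc_of _).
have [e /eqP <-] := arc_of_surj a.
(* A common default makes the extensions of [w1] and [w2] agree on labels that name no edge of
   [D']. *)
pose u w := extend f' (w \o @arc_of D') (w1 (arc_of e)).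
suff : {in labels K', u w1 =1 u w2}.
  move=> /(_ (f' e)); rewrite /u !extendE //; apply.
  by apply/(mem_labels_encoding fDK'); exists e.
apply: huniq; try exact: colors_extend.
move=> l lZ; rewrite /u /extend; case: pickP => //= e' /eqP e'l.
(* A label off [Z] that names an edge of [D'] also names an edge of [D], whose color under [w] fixes
   both values. *)
have /hl : l \notin Z by [].
have lK' : l \in labels K' by apply/(mem_labels_encoding fDK'); exists e'.
move/(_ lK')/(mem_labels_encoding fDK) => [d dl].
by rewrite -(c1 d) -?(c2 d) ?e'l ?dl.
Qed.

Lemma diagram_step_transfers (D D' : diagram) : diagram_step D D' ->
  exists f f' Z, transfers (D := D) (D' := D') f f' Z
                 /\ transfers (D := D') (D' := D) f' f Z.
Proof.
case=> K [K' [[f f_inj fDK] [f' f'_inj fDK'] KK']].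
have lKK' : linked K K'.
  case: KK' => [->|]; first exact: linked_refl.
  by apply: move_linked; [apply: uniq_halves_encoding fDK'
                         |apply: balanced_encoding fDK'].
have h0 := linked_nil lKK'; have h0' := linked_nil (linked_sym lKK').
have [Z [hl hZ]] := lKK'; exists f, f', Z; split.
  apply: (transfers_encoding (K := K) (K' := K')) => // [l /hl->//|Y op /hZ[]//].
by apply: (transfers_encoding (K := K') (K' := K)) => // [l /hl->//|Y op /hZ[]//].
Qed.

(** * Kernels and quivers *)

Section ModuleSize.
Local Open Scope ring_scope.
Variable R : comPzRingType.
Implicit Type N : lmodType R.

Definition lmod_iso N (N' : lmodType R) := exists g : {linear N -> N'}, bijective g.

Lemma lmod_iso_sym N (N' : lmodType R) : lmod_iso N N' -> lmod_iso N' N.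
Proof.
case=> g [g' gK g'K].
pose g'_linear := GRing.isLinear.Build R N' N *:%R g' (can2_linear gK g'K).
by exists (HB.pack_for {linear N' -> N} g' g'_linear); exists g.
Qed.

Lemma free_summand_iso N (N' : lmodType R) r :
  lmod_iso N N' -> free_summand N' r -> free_summand N r.
Proof.
move=> [g bg] [T [h bh]]; exists T, [the {linear _ -> _} of h \o g].
exact: bij_comp.
Qed.

Lemma module_size_iso N (N' : lmodType R) :
  lmod_iso N N' -> module_size N = module_size N'.
Proof.
move=> isoN; have isoN' := lmod_iso_sym isoN.
rewrite /module_size; case: asboolP => _; last first.
  (* [free_rank] depends on the module only through this predicate. *)
  have fsE : free_summand N = free_summand N'.
    by apply/funext => r; apply/propext; split; apply: free_summand_iso.
  by rewrite /free_rank fsE.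
have [g [g' gK g'K]] := isoN.
have eN : ([set: N] #= [set: N'])%classic%card.
  have <- : (g @` [set: N] = [set: N'])%classic.
    by apply/seteqP; split=> // y _; exists (g' y).
  rewrite card_eq_sym; apply: inj_card_eq => x y _ _; exact: (can_inj gK).
case: (pselect (finite_set [set: N]%classic)) => fN.
  by apply/fcard_eq => //; rewrite -(eq_finite_set eN).
(* If [N] is infinite then so is [N'], and [fset_set] takes its default value on both. *)
rewrite /fset_set; case: pselect => // _; case: pselect => // fN'.
by case: fN; rewrite (eq_finite_set eN).
Qed.

End ModuleSize.

(** * The quandle X * R, and kernel elements as its colorings *)

Section Colorings.
Local Open Scope ring_scope.
Variables (X : finQuandleType) (R : comPzRingType) (t s : X -> X -> R).
Hypothesis hts : quandle_module t s.

Lemma quandle_law_qop : quandle_law (@qop X).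
Proof.
split=> [x|y x x'|y x|x y z]; first exact: qop_idem; last exact: qop_dist.
- exact: (bij_inj (qop_bij y)).
- by have [g _ gK] := qop_bij y; exists (g x); apply: gK.
Qed.

Definition ext_op (p q : X * R) : X * R :=
  (p.1 ▷ q.1, t p.1 q.1 * p.2 + s p.1 q.1 * q.2).

(** Idempotence is [qmod_diag], and bijectivity comes from the invertibility of [t]. In
    distributivity the coefficients of [a], [b], [c] match by [qmod_tt], [qmod_ts], [qmod_ss]
    respectively. *)
Lemma quandle_law_ext : quandle_law ext_op.
Proof.
split=> [[x a]|[y b] [x a] [x' a']|[y b] [x a]|[x a] [y b] [z c]]; rewrite /ext_op /=.
- by rewrite qop_idem -mulrDl (qmod_diag hts) mul1r.
- case=> /(law_inj quandle_law_qop)<- /addIr e.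
  have [v hv] := qmod_unit hts x y.
  by rewrite -[a]mul1r -[a']mul1r -hv ![_ * v * _]mulrAC e.
- have [z <-] := law_surj quandle_law_qop y x.
  have [v hv] := qmod_unit hts z y.
  by exists (z, v * (a - s z y * b)); rewrite /= mulrA hv mul1r subrK.
rewrite (qop_dist x y z); congr (_, _).
rewrite !mulrDr !mulrA (qmod_tt hts) (qmod_ts hts) (qmod_ss hts x y z) mulrDl.
by rewrite -!addrA; congr (_ + _); rewrite addrCA.
Qed.

Section Diagram.
Variable D : diagram.

Lemma forall_crossing (P : crossing (arc D) -> Prop) :
  (forall k, P (nth_crossing k)) <->
  (forall c, c \in crossings D -> P (map_crossing (@arc_of D) c)).
Proof.
split=> [h c /(tnthP (in_tuple (crossings D)))[k ->]|h k]; first exact: h.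
by apply: h; apply: mem_tnth.
Qed.

Lemma coloring_arc_colors (C : coloring X D) : arc_colors (@qop X) C.
Proof.
case: C => C hC /=; have /forallP h := hC.
apply/(forall_crossing (fun c =>
  C (under_left c) = C (under_right c) ▷ C (over_in c))) => k.
exact/eqP/h.
Qed.

Lemma arc_colors_coloring (w : arc D -> X) : arc_colors (@qop X) w ->
  exists C : coloring X D, C =1 w.
Proof.
move=> hw; have hC : [forall k, let c := nth_crossing k in
    finfun w (under_left c) == finfun w (under_right c) ▷ finfun w (over_in c)].
  apply/forallP => k; rewrite /= !ffunE; apply/eqP.
  exact: (forall_crossing (fun c =>
    w (under_left c) = w (under_right c) ▷ w (over_in c))).2 hw k.
by exists (Coloring hC) => a; rewrite /= ffunE.
Qed.

Definition beads (v : 'cV[R]_#|{: arc D}|) (a : arc D) : R := v (enum_rank a) 0.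

Lemma sum_beads (v : 'cV[R]_#|{: arc D}|) (a : arc D) :
  \sum_j (a == enum_val j)%:R * v j 0 = beads v a.
Proof.
rewrite (bigD1 (enum_rank a)) //= enum_rankK eqxx mul1r big1 ?addr0 // => j.
by rewrite -(inj_eq enum_val_inj) enum_rankK eq_sym => /negbTE ->; rewrite mul0r.
Qed.

(** Each matrix row is the second coordinate of a crossing equation in X * R; the first coordinate
    holds because [C] is a coloring. *)
Lemma ker_arc_colors (C : coloring X D) v :
  v \in ker_pred (module_matrix t s C) <->
  arc_colors ext_op (fun a => (C a, beads v a)).
Proof.
have rowE k : let c := nth_crossing k in
    (module_matrix t s C *m v) k 0 =
    beads v (under_left c)
    - t (C (under_right c)) (C (over_in c)) * beads v (under_right c)
    - s (C (under_right c)) (C (over_in c)) * beads v (over_in c).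
  rewrite /= mxE -!sum_beads !mulr_sumr -!sumrB; apply: eq_bigr => j _.
  by rewrite mxE !mulrBl !mulrA.
set eqn := fun c : crossing (arc D) => (C (under_left c), beads v (under_left c)) =
  ext_op (C (under_right c), beads v (under_right c))
         (C (over_in c), beads v (over_in c)).
apply: iff_trans (forall_crossing eqn).
split=> [|h]; last first.
  rewrite inE; apply/eqP/matrixP => k j; rewrite ord1 rowE mxE.
  by case: (h k) => _ ->; rewrite -addrA -opprD subrr.
rewrite inE => /eqP/matrixP h k; rewrite /eqn /ext_op /=; congr (_, _).
  have := coloring_arc_colors C.
  by move/(forall_crossing (fun c => C (under_left c) =
    C (under_right c) ▷ C (over_in c))).2; apply.
by have := h k 0; rewrite rowE mxE -addrA -opprD => /subr0_eq.
Qed.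

End Diagram.

(** * Transfer of colorings and kernel elements between two diagrams *)

Section Transfer.
Variables (D D' : diagram) (f : edge D -> nat) (f' : edge D' -> nat) (Z : seq nat).
Hypothesis hDD' : transfers f f' Z.

Local Notation "w ~~> w'" := (compatible f f' Z w w') (at level 70).

Lemma coloring_transfer (C : coloring X D) : exists C' : coloring X D', C ~~> C'.
Proof.
have [w' hw' Cw'] := (hDD' quandle_law_qop).1 _ (coloring_arc_colors C).
have [C' C'E] := arc_colors_coloring hw'.
by exists C' => e e' ee' eZ; rewrite C'E; apply: Cw'.
Qed.

Lemma coloring_transfer_uniq (C : coloring X D) (C1 C2 : coloring X D') :
  C ~~> C1 -> C ~~> C2 -> C1 = C2.
Proof.
move=> h1 h2; apply/val_inj/ffunP.
exact: ((hDD' quandle_law_qop).2 C C1 C2 (coloring_arc_colors _)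
  (coloring_arc_colors _) h1 h2).
Qed.

Variables (C : coloring X D) (C' : coloring X D').
Hypothesis CC' : C ~~> C'.

Lemma ker_transfer (v : ker (module_matrix t s C)) :
  exists v' : ker (module_matrix t s C'), beads v ~~> beads v'.
Proof.
have /ker_arc_colors hv := valP v.
have [w' hw' vw'] := (hDD' quandle_law_ext).1 _ hv.
(* The first projection of [w'] is an X-coloring compatible with [C], so uniqueness identifies it
   with [C']; hence the second coordinates solve the equations over [C'] itself. *)
have w'C' a : (w' a).1 = C' a.
  apply: ((hDD' quandle_law_qop).2 C (fun a => (w' a).1) C') => //.
  - by move=> c cD; rewrite hw'.
  - exact: coloring_arc_colors.
  by move=> e e' ee' eZ; rewrite -(vw' e e').
pose v' := \col_j (w' (enum_val j)).2 : 'cV[R]_#|{: arc D'}|.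
have v'E a : beads v' a = (w' a).2 by rewrite /beads mxE enum_rankK.
have v'K : v' \in ker_pred (module_matrix t s C').
  apply/ker_arc_colors => c cD; rewrite !v'E -!w'C' -!surjective_pairing.
  exact: hw'.
by exists (Ker v'K) => e e' ee' eZ; rewrite v'E -(vw' e e').
Qed.

Lemma ker_transfer_uniq (v : ker (module_matrix t s C))
    (v1 v2 : ker (module_matrix t s C')) :
  beads v ~~> beads v1 -> beads v ~~> beads v2 -> v1 = v2.
Proof.
move=> h1 h2.
have e12 a : (C' a, beads v1 a) = (C' a, beads v2 a).
  apply: ((hDD' quandle_law_ext).2 (fun a => (C a, beads v a))
    (fun a => (C' a, beads v1 a)) (fun a => (C' a, beads v2 a))).
  - exact/ker_arc_colors/(valP v1).
  - exact/ker_arc_colors/(valP v2).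
  - by move=> e e' ee' eZ; rewrite (CC' ee') // (h1 e e').
  - by move=> e e' ee' eZ; rewrite (CC' ee') // (h2 e e').
apply/val_inj/colP => j; have [] := e12 (enum_val j).
by rewrite /beads enum_valK.
Qed.

End Transfer.

End Colorings.

(** * Isomorphism of the quivers of two diagrams related by one step *)

Section Invariance.
Local Open Scope ring_scope.
Variables (X : finQuandleType) (R : comPzRingType) (t s : X -> X -> R).
Hypothesis hts : quandle_module t s.
Variables (D D' : diagram) (f : edge D -> nat) (f' : edge D' -> nat) (Z : seq nat).
Hypotheses (hDD' : transfers f f' Z) (hD'D : transfers f' f Z).

Lemma ker_iso (C : coloring X D) (C' : coloring X D') : compatible f f' Z C C' ->
  lmod_iso (ker (module_matrix t s C)) (ker (module_matrix t s C')).
Proof.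
move=> CC'; have C'C := compatible_sym CC'.
have [g gP] := choice (ker_transfer hts hDD' CC').
have [g' g'P] := choice (ker_transfer hts hD'D C'C).
have g_linear : linear g.
  (* Compatibility is preserved by linear combinations, so uniqueness of the transferred element
     gives linearity. *)
  move=> a u v; apply: (ker_transfer_uniq hts hDD' CC' (gP _)) => e e' ee' eZ.
  have := gP u e e' ee' eZ; have := gP v e e' ee' eZ.
  by rewrite /beads !mxE => -> ->.
pose gL := GRing.isLinear.Build R _ _ *:%R g g_linear.
exists (HB.pack_for
  {linear ker (module_matrix t s C) -> ker (module_matrix t s C')} g gL).
exists g' => v.
  apply: (ker_transfer_uniq hts hD'D C'C (g'P _)).
  exact: compatible_sym (gP v).
apply: (ker_transfer_uniq hts hDD' CC' (gP _)).
exact: compatible_sym (g'P v).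
Qed.

Lemma transfers_quiver_iso (S : {set quandle_end X}) :
  quiver_iso (quandle_module_quiver S t s D) (quandle_module_quiver S t s D').
Proof.
have [phi phiP] := choice (coloring_transfer (X := X) hDD').
have [phi' phi'P] := choice (coloring_transfer (X := X) hD'D).
have phiK : cancel phi phi'.
  move=> C; apply: (coloring_transfer_uniq hD'D (phi'P _)).
  exact: compatible_sym (phiP C).
have phi'K : cancel phi' phi.
  move=> C; apply: (coloring_transfer_uniq hDD' (phiP _)).
  exact: compatible_sym (phi'P C).
exists phi, (fun e => (phi e.1, e.2)); split=> //.
- by exists phi'.
- by exists (fun e => (phi' e.1, e.2)) => -[C g] /=; rewrite ?phiK ?phi'K.
(* Applying [g] preserves compatibility, so the image of [phi C] under [g] is also compatible with
   that of [C]. *)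
- move=> [C g] /=; apply/esym/(coloring_transfer_uniq hDD' (phiP _)).
  by move=> e e' ee' eZ; rewrite /= !ffunE (phiP C e e').
- move=> C /=; apply: module_size_iso; apply: lmod_iso_sym.
  exact: ker_iso.
Qed.

End Invariance.

(** * Quiver isomorphism as an equivalence relation, and sequences of steps *)

Lemma quiver_iso_refl Q : quiver_iso Q Q.
Proof. by exists id, id; split=> //; exists id. Qed.

Lemma quiver_iso_sym Q Q' : quiver_iso Q Q' -> quiver_iso Q' Q.
Proof.
case=> phi [psi [[phi' phiK phi'K] [psi' psiK psi'K] hs ht hw]].
exists phi', psi'; split.
- by exists phi.
- by exists psi.
- by move=> e; apply: (can_inj phiK); rewrite phi'K -hs psi'K.
- by move=> e; apply: (can_inj phiK); rewrite phi'K -ht psi'K.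
- by move=> v; rewrite -hw phi'K.
Qed.

Lemma quiver_iso_trans Q1 Q2 Q3 :
  quiver_iso Q1 Q2 -> quiver_iso Q2 Q3 -> quiver_iso Q1 Q3.
Proof.
case=> phi [psi [bphi bpsi hs ht hw]] [phi' [psi' [bphi' bpsi' hs' ht' hw']]].
exists (phi' \o phi), (psi' \o psi); split; try exact: bij_comp.
- by move=> e; rewrite /= hs' hs.
- by move=> e; rewrite /= ht' ht.
- by move=> v; rewrite /= hw' hw.
Qed.

Theorem theorem3 (X : finQuandleType) (S : {set quandle_end X})
    (R : comPzRingType) (t s : X -> X -> R) (hts : quandle_module t s)
    (D D' : diagram) (hDD' : same_link D D') :
  quiver_iso (quandle_module_quiver S t s D) (quandle_module_quiver S t s D').
Proof.
elim: hDD' => {D D'} [D D'|D|D D' _|D1 D2 D3 _ h12 _].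
- by case/diagram_step_transfers=> f [f' [Z [h h']]]; apply: transfers_quiver_iso h h' _.
- exact: quiver_iso_refl.
- exact: quiver_iso_sym.
- exact: quiver_iso_trans h12.
Qed.
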